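(* Let $r>0$, $0<\alpha<1$ and $\mu>0$. Let $f:\mathbb{R}^n\to\mathbb{R}$ be a differentiable $\mu$-strongly convex function with minimum value $f_*$. Let $x:(0,\infty)\to\mathbb{R}^n$ be a twice differentiable solution of $$\ddot{x}(t)+\frac{r}{t^{\alpha}}\dot{x}(t)+\nabla f(x(t))=0,\qquad t>0.$$ Put $T=\left(\frac{2r^2}{9\mu}\right)^{\frac{1}{2\alpha}}$. Then $$f(x(t))-f_*=\mathrm{O}\left(\mathrm{e}^{-\frac{2}{3}\frac{r}{1-\alpha}t^{1-\alpha}}\right)\qquad\text{for } t\ge T.$$
   Context: $\|\cdot\|$ and $\langle\cdot,\cdot\rangle$ are the Euclidean norm and inner product on $\mathbb{R}^n$. For $\mu>0$, a differentiable function $f:\mathbb{R}^n\to\mathbb{R}$ is $\mu$-strongly convex if $f(y)\ge f(x)+\langle\nabla f(x),y-x\rangle+\frac{\mu}{2}\|y-x\|^2$ for all $x,y\in\mathbb{R}^n$. The notation $\phi(t)=\mathrm{O}(\psi(t))$ for $t\ge T$ (with $\psi>0$) means that there is a constant $C$, independent of $t$ (but possibly depending on $f$, $r$, $\alpha$ and the solution $x$), such that $|\phi(t)|\le C\psi(t)$ for all $t\ge T$. *)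

(* Defs.v *)
From HB Require Import structures.
From mathcomp Require Import all_boot all_order all_algebra.
From mathcomp Require Import all_classical all_reals all_analysis.

Set Implicit Arguments.
Unset Strict Implicit.
Unset Printing Implicit Defensive.
Import Order.TTheory GRing.Theory Num.Theory.
Import numFieldNormedType.Exports.
Local Open Scope ring_scope.

(* R^n is 'rV[R]_n.  The library's norm `|u| on it is the sup norm, hence the
   separate Euclidean structure below; differentiability does not depend on
   which of the two norms is used. *)

Definition dotv (R : realType) (n : nat) (u v : 'rV[R]_n) : R :=
  \sum_(i < n) u ord0 i * v ord0 i.

Definition enorm (R : realType) (n : nat) (u : 'rV[R]_n) : R :=
  Num.sqrt (dotv u u).

Definition gradient (R : realType) (n : nat) (f : 'rV[R]_n -> R)
    (x : 'rV[R]_n) : 'rV[R]_n :=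
  \row_(i < n) 'D_(delta_mx ord0 i) f x.

(* Meaningful for mu > 0 and f differentiable everywhere. *)
Definition strongly_convex (R : realType) (n : nat) (mu : R)
    (f : 'rV[R]_n -> R) : Prop :=
  forall x y : 'rV[R]_n,
    f x + dotv (gradient f x) (y - x) + mu / 2 * enorm (y - x) ^+ 2 <= f y.

Definition is_minimum_value (R : realType) (n : nat) (f : 'rV[R]_n -> R)
    (fstar : R) : Prop :=
  (exists xstar : 'rV[R]_n, f xstar = fstar) /\
  (forall y : 'rV[R]_n, fstar <= f y).

(* The trajectory lives on (0, +oo): x is a total function R -> R^n whose values
   at t <= 0 are irrelevant, since derivatives at t > 0 are local. *)
Definition is_solution (R : realType) (n : nat) (r alpha : R)
    (f : 'rV[R]_n -> R) (x : R -> 'rV[R]_n) : Prop :=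
  forall t : R, 0 < t ->
    [/\ derivable x t 1, derivable (derive1 x) t 1 &
        derive1 (derive1 x) t + (r / t `^ alpha) *: derive1 x t
          + gradient f (x t) = 0].

(* phi t = O(psi t) for t >= T: one constant for the whole half-line, as opposed
   to the eventual bound of the library's bigO at +oo. *)
Definition bigO_from (R : realType) (T : R) (phi psi : R -> R) : Prop :=
  exists C : R, forall t : R, T <= t -> `|phi t| <= C * psi t.

(* Main.v *)
Require Import Defs.
From HB Require Import structures.
From mathcomp Require Import all_boot all_order all_algebra.
From mathcomp Require Import ring lra.
From mathcomp Require Import all_classical all_reals all_analysis.
Set Implicit Arguments.
Unset Strict Implicit.
Unset Printing Implicit Defensive.
Import Order.TTheory GRing.Theory Num.Theory.
Import numFieldNormedType.Exports.
Local Open Scope ring_scope.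

(** Along the trajectory, put z = x - x* for a minimiser x*, v = x', and let
l = (2/3) r t^(-alpha) be two thirds of the damping coefficient, whose
primitive L = (2/3) (r / (1 - alpha)) t^(1 - alpha) is the exponent of the
announced rate.  The proof exhibits a Lyapunov function decaying at rate l:

  W = f(x) - f* + |v|^2 / 2 + l <v, z> + (l^2 / 4 - l' / 2) |z|^2.

The weights are forced.  With x'' = - (3/2) l v - grad f(x), the terms in
<grad f(x), v> and |v|^2 cancel in W' + l W, and the terms in <v, z> cancel for
this coefficient of |z|^2 and no other.  What remains is
  l (f(x) - f* - <grad f(x), z>) + (l^3 / 4 - l'' / 2) |z|^2,
and strong convexity bounds the bracket by - (mu / 2) |z|^2.  As l'' >= 0, this
gives W' + l W <= 0 as soon as l^2 <= 2 mu ([lyapunov_rate_le]), so that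
exp(L) W is nonincreasing ([exp_weighted_nincr]).

The threshold l^2 <= 2 mu is exactly t >= T.  To bound W below, completing the
square in |v + l z|^2 leaves - (l^2 / 4) |z|^2 to be absorbed by f(x) - f*,
which may use up all of f(x) - f* at time T.  Waiting until l^2 <= mu / 2, that
is until some T1 > T, makes this loss at most half of f(x) - f*
([lyapunov_ge_half_gap]), which yields the rate on [T1, +oo).  On the compact
interval [T, T1] the estimate holds by continuity, at the price of a larger
constant ([bigO_from_extend]). *)

(** * The Euclidean inner product *)

Lemma dotvC (R : realType) (n : nat) (u v : 'rV[R]_n) : dotv u v = dotv v u.
Proof. by apply: eq_bigr => i _; rewrite mulrC. Qed.

Lemma dotvDl (R : realType) (n : nat) (u v w : 'rV[R]_n) :
  dotv (u + v) w = dotv u w + dotv v w.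
Proof. by rewrite -big_split; apply: eq_bigr => i _; rewrite mxE mulrDl. Qed.

Lemma dotvZl (R : realType) (n : nat) (k : R) (u w : 'rV[R]_n) :
  dotv (k *: u) w = k * dotv u w.
Proof. by rewrite mulr_sumr; apply: eq_bigr => i _; rewrite mxE mulrA. Qed.

Lemma dotvNl (R : realType) (n : nat) (u w : 'rV[R]_n) :
  dotv (- u) w = - dotv u w.
Proof. by rewrite -scaleN1r dotvZl mulN1r. Qed.

Lemma dotvDr (R : realType) (n : nat) (u v w : 'rV[R]_n) :
  dotv w (u + v) = dotv w u + dotv w v.
Proof. by rewrite !(dotvC w) dotvDl. Qed.

Lemma dotvZr (R : realType) (n : nat) (k : R) (u w : 'rV[R]_n) :
  dotv w (k *: u) = k * dotv w u.
Proof. by rewrite !(dotvC w) dotvZl. Qed.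

Lemma dotvNr (R : realType) (n : nat) (u w : 'rV[R]_n) :
  dotv w (- u) = - dotv w u.
Proof. by rewrite !(dotvC w) dotvNl. Qed.

Lemma dotvv_ge0 (R : realType) (n : nat) (u : 'rV[R]_n) : 0 <= dotv u u.
Proof. by apply: sumr_ge0 => i _; rewrite -expr2 sqr_ge0. Qed.

Lemma enorm_sqr (R : realType) (n : nat) (u : 'rV[R]_n) :
  enorm u ^+ 2 = dotv u u.
Proof. by rewrite sqr_sqrtr// dotvv_ge0. Qed.

(** * Differentiation along a curve *)

Lemma is_derive_dotv (R : realType) (n : nat) (u v : R -> 'rV[R]_n)
    (du dv : 'rV[R]_n) (t : R) :
  is_derive t 1 u du -> is_derive t 1 v dv ->
  is_derive t 1 (fun s => dotv (u s) (v s)) (dotv du (v t) + dotv (u t) dv).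
Proof.
have coord (w : R -> 'rV[R]_n) dw i : is_derive t 1 w dw ->
    is_derive t 1 (fun s => w s ord0 i) (dw ord0 i).
  move=> [w_derivable <-]; split; first exact: (derivable_mxP _ _ _).1.
  by rewrite derive_mx// mxE.
move=> hu hv.
have -> : (fun s => dotv (u s) (v s)) =
    \sum_(i < n) (fun s => u s ord0 i * v s ord0 i).
  by apply/funext => s; rewrite fct_sumE.
rewrite /dotv -big_split /=; apply: is_derive_sum => i.
apply: (is_derive_eq (is_deriveM (coord _ _ i hu) (coord _ _ i hv))).
by rewrite /GRing.scale /= addrC (mulrC (v t _ _)).
Qed.

Lemma diff_dotv_gradient (R : realType) (n : nat) (f : 'rV[R]_n -> R)
    (z v : 'rV[R]_n) :
  differentiable f z -> 'd f z v = dotv (gradient f z) v.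
Proof.
move=> df; rewrite {1}(row_sum_delta v) linear_sum; apply: eq_bigr => i _.
by rewrite linearZ /= mxE deriveE// mulrC.
Qed.

Lemma is_derive_along (R : realType) (n : nat) (f : 'rV[R]_n -> R)
    (x : R -> 'rV[R]_n) (dx : 'rV[R]_n) (t : R) :
  differentiable f (x t) -> is_derive t 1 x dx ->
  is_derive t 1 (fun s => f (x s)) (dotv (gradient f (x t)) dx).
Proof.
move=> df [/derivable1_diffP dxt <-].
have dfx : differentiable (f \o x) t by exact: differentiable_comp.
split; first exact/derivable1_diffP.
by rewrite (deriveE _ dfx) diff_comp //= -(deriveE _ dxt) diff_dotv_gradient.
Qed.

(** * Consequences of strong convexity *)

Lemma strongly_convex_gradient_le (R : realType) (n : nat) (mu : R)
    (f : 'rV[R]_n -> R) (x y : 'rV[R]_n) : strongly_convex mu f ->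
  f x - f y + mu / 2 * dotv (x - y) (x - y) <= dotv (gradient f x) (x - y).
Proof.
move=> /(_ x y); rewrite enorm_sqr -(opprB x y) !(dotvNl, dotvNr) opprK.
lra.
Qed.

(** Adding the strong convexity inequalities from the midpoint to both ends
cancels the gradient terms.  The optimal constant is mu / 2, which comes from
grad f(xstar) = 0; the factor 2 lost here only delays the time from which the
Lyapunov function controls the gap. *)
Lemma strongly_convex_quadratic_growth (R : realType) (n : nat) (mu : R)
    (f : 'rV[R]_n -> R) (x xstar : 'rV[R]_n) :
  strongly_convex mu f -> (forall y, f xstar <= f y) ->
  mu / 4 * dotv (x - xstar) (x - xstar) <= f x - f xstar.
Proof.
move=> fconv fmin; pose d := 2^-1 *: (x - xstar); pose m := xstar + d.
have xm : x - m = d.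
  by apply/rowP => i; rewrite !mxE; lra.
have sm : xstar - m = - d by rewrite /m opprD addNKr.
have := fconv m x; have := fconv m xstar; have := fmin m.
rewrite !enorm_sqr xm sm !(dotvNl, dotvNr) opprK.
rewrite /d !(dotvZl, dotvZr); lra.
Qed.

(** * The Lyapunov function *)

(** Differential form of Gronwall's inequality with a variable rate: the
derivative of exp(L) W is exp(L) (W' + l W). *)
Lemma exp_weighted_nincr (R : realType) (a : R) (L l W dW : R -> R) :
  (forall t, a <= t -> is_derive t 1 L (l t)) ->
  (forall t, a <= t -> is_derive t 1 W (dW t)) ->
  (forall t, a <= t -> dW t + l t * W t <= 0) ->
  forall t, a <= t -> expR (L t) * W t <= expR (L a) * W a.
Proof.
move=> hL hW hle t at_.
have hG s : a <= s -> is_derive s 1 (fun s => expR (L s) * W s)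
    (expR (L s) * (dW s + l s * W s)).
  move=> as_; have hL' := hL _ as_; have hW' := hW _ as_.
  have hE : is_derive s 1 (expR \o L) (expR (L s) * l s).
    exact: (is_derive1_comp (is_derive_expR _) hL').
  apply: (is_derive_eq (is_deriveM hE hW')).
  by rewrite /GRing.scale /=; ring.
have hD s : a <= s -> derivable (fun s => expR (L s) * W s) s 1.
  by move=> /hG[].
apply: (@ler0_derive1_nincr _ (fun s => expR (L s) * W s) a t) => //.
- by move=> s; rewrite in_itv/= => /andP[/ltW as_ _]; exact: hD.
- move=> s; rewrite in_itv/= => /andP[/ltW as_ _].
  rewrite derive1E; have [_ ->] := hG _ as_.
  by rewrite mulr_ge0_le0 ?expR_ge0 ?hle.
- by apply: derivable_within_continuous => s; rewrite in_itv/= => /andP[/hD].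
Qed.

(** Completing the square, this is
f(x) - f* + |v + l z|^2 / 2 - (l^2 / 4 + l' / 2) |z|^2: the usual energy of an
inertial system shifted by l z, with the multiple of |z|^2 that cancels <v, z>
in W' + l W. *)
Definition lyapunov (R : realType) (n : nat) (f : 'rV[R]_n -> R)
    (xstar : 'rV[R]_n) (x : R -> 'rV[R]_n) (l dl : R -> R) (t : R) : R :=
  f (x t) - f xstar + 2^-1 * dotv (derive1 x t) (derive1 x t)
  + l t * dotv (derive1 x t) (x t - xstar)
  + (l t ^+ 2 / 4 - dl t / 2) * dotv (x t - xstar) (x t - xstar).

(** The time derivative of [lyapunov] before the differential equation is
used, with the acceleration not yet eliminated. *)
Definition lyapunov_rate (R : realType) (n : nat) (f : 'rV[R]_n -> R)
    (xstar : 'rV[R]_n) (x : R -> 'rV[R]_n) (l dl ddl : R -> R) (t : R) : R :=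
  dotv (gradient f (x t)) (derive1 x t)
  + dotv (derive1 (derive1 x) t) (derive1 x t)
  + dl t * dotv (derive1 x t) (x t - xstar)
  + l t * (dotv (derive1 (derive1 x) t) (x t - xstar)
           + dotv (derive1 x t) (derive1 x t))
  + (l t * dl t / 2 - ddl t / 2) * dotv (x t - xstar) (x t - xstar)
  + (l t ^+ 2 / 4 - dl t / 2) * (2 * dotv (derive1 x t) (x t - xstar)).

Lemma is_derive_lyapunov (R : realType) (n : nat) (f : 'rV[R]_n -> R)
    (xstar : 'rV[R]_n) (x : R -> 'rV[R]_n) (l dl ddl : R -> R) (t : R) :
  differentiable f (x t) -> derivable x t 1 -> derivable (derive1 x) t 1 ->
  is_derive t 1 l (dl t) -> is_derive t 1 dl (ddl t) ->
  is_derive t 1 (lyapunov f xstar x l dl)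
    (lyapunov_rate f xstar x l dl ddl t).
Proof.
move=> df /derivableP dx /derivableP ddx hl hdl.
rewrite -!derive1E in dx ddx.
have hc (c : R) : is_derive t 1 (cst c) 0 by exact: is_derive_cst.
have dz : is_derive t 1 (fun s => x s - xstar) (derive1 x t).
  apply: (is_derive_eq (is_deriveB dx (is_derive_cst xstar t 1))).
  by rewrite subr0.
have hf := is_derive_along df dx.
have hvv := is_derive_dotv ddx ddx.
have hvz := is_derive_dotv ddx dz.
have hzz := is_derive_dotv dz dz.
have hq := is_deriveB (is_deriveM (is_deriveM hl hl) (hc 4^-1))
  (is_deriveM hdl (hc 2^-1)).
have hW := is_deriveD (is_deriveD (is_deriveD
  (is_deriveB hf (hc (f xstar)))
  (is_deriveM (hc 2^-1) hvv))
  (is_deriveM hl hvz)) (is_deriveM hq hzz).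
refine (is_derive_eq hW _); rewrite /lyapunov_rate /GRing.scale /= /cst.
rewrite !fctE; move: (derive1 x t) (derive1 (derive1 x) t) (x t - xstar).
move=> v a z; rewrite (dotvC z v) (dotvC v a).
move: (dotv a v) (dotv a z) (dotv v v) (dotv v z) (dotv z z) (l t) (dl t).
by move=> av az vv vz zz lt dlt; field.
Qed.

(** After substituting the equation, the difference between 0 and the left-hand
side is the sum of l times the slack in the gradient inequality, of
(l / 4) (2 mu - l^2) |z|^2 and of (l'' / 2) |z|^2. *)
Lemma lyapunov_rate_le (R : realType) (n : nat) (mu : R) (f : 'rV[R]_n -> R)
    (xstar : 'rV[R]_n) (x : R -> 'rV[R]_n) (l dl ddl : R -> R) (t : R) :
  strongly_convex mu f ->
  derive1 (derive1 x) t + (3 / 2 * l t) *: derive1 x t + gradient f (x t) = 0 ->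
  0 <= l t -> l t ^+ 2 <= 2 * mu -> 0 <= ddl t ->
  lyapunov_rate f xstar x l dl ddl t + l t * lyapunov f xstar x l dl t <= 0.
Proof.
move=> fconv ode l0 l2 ddl0.
have := strongly_convex_gradient_le (x t) xstar fconv.
have := dotvv_ge0 (x t - xstar).
rewrite /lyapunov_rate /lyapunov.
move: ode; rewrite -addrA => /eqP; rewrite addr_eq0 => /eqP ->.
set phi := f (x t) - f xstar; move: (x t - xstar) => z.
rewrite !dotvNl !dotvDl !dotvZl.
move: (dotv (gradient f (x t)) z) (dotv z z) => gz zz zz0 hgz.
have h1 : l t * (phi + mu / 2 * zz) <= l t * gz by exact: ler_wpM2l.
have h2 : 0 <= l t * zz * (2 * mu - l t ^+ 2).
  by rewrite !mulr_ge0// subr_ge0.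
have h3 : 0 <= ddl t * zz by rewrite mulr_ge0.
by nra.
Qed.

(** Dropping |v + l z|^2 / 2 and - (l' / 2) |z|^2, W is at least
f(x) - f* - (l^2 / 4) |z|^2, and quadratic growth bounds the last term by half
the gap precisely when l^2 <= mu / 2. *)
Lemma lyapunov_ge_half_gap (R : realType) (n : nat) (mu : R)
    (f : 'rV[R]_n -> R) (xstar : 'rV[R]_n) (x : R -> 'rV[R]_n)
    (l dl : R -> R) (t : R) :
  strongly_convex mu f -> (forall y, f xstar <= f y) ->
  l t ^+ 2 <= mu / 2 -> dl t <= 0 ->
  (f (x t) - f xstar) / 2 <= lyapunov f xstar x l dl t.
Proof.
move=> fconv fmin l2 dl0.
have := strongly_convex_quadratic_growth (x t) fconv fmin.
have := dotvv_ge0 (derive1 x t + l t *: (x t - xstar)).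
have := dotvv_ge0 (x t - xstar).
rewrite /lyapunov; move: (x t - xstar) => z.
rewrite dotvDl !dotvDr !dotvZl !dotvZr (dotvC z (derive1 x t)).
move: (dotv z z) => zz zz0 hv hq.
have h1 : 0 <= (mu / 2 - l t ^+ 2) * zz by rewrite mulr_ge0// subr_ge0.
have h2 : 0 <= - dl t * zz by rewrite mulr_ge0// oppr_ge0.
by nra.
Qed.

(** * Powers of time and the domain of the estimate *)

Lemma is_derive_mulr_powR (R : realType) (c a t : R) : 0 < t ->
  is_derive t 1 (fun s => c * s `^ a) (c * a * t `^ (a - 1)).
Proof.
move=> t0.
have hc : is_derive t 1 (cst c) 0 by exact: is_derive_cst.
apply: (is_derive_eq (is_deriveM hc (is_derive1_powR a t0))).
by rewrite /GRing.scale /= /cst mulr0 addr0 mulrA.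
Qed.

Lemma le_sqr_powR (R : realType) (alpha c t : R) : 0 < alpha -> 0 <= c ->
  c `^ (1 / (2 * alpha)) <= t -> c <= (t `^ alpha) ^+ 2.
Proof.
move=> a0 c0 ct; have t0 : 0 <= t by exact: le_trans (powR_ge0 _ _) ct.
rewrite -powR_mulrn ?powR_ge0// -powRrM.
have -> : c = (c `^ (1 / (2 * alpha))) `^ (alpha * 2%:R).
  rewrite -powRrM (_ : _ * _ = 1) ?powRr1//.
  by field; rewrite gt_eqF.
by apply: ge0_ler_powR; rewrite ?nnegrE ?powR_ge0// mulr_ge0// ltW.
Qed.

(** Lowering the starting time of the estimate only requires a bound on the
compact interval [T, T1], provided there by the extreme value theorem. *)
Lemma bigO_from_extend (R : realType) (T T1 : R) (phi L : R -> R) :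
  {within `[T, T1], continuous (fun t => phi t * expR (L t))}%classic ->
  T <= T1 -> (forall t, 0 <= phi t) ->
  bigO_from T1 phi (fun t => expR (- L t)) ->
  bigO_from T phi (fun t => expR (- L t)).
Proof.
move=> cont TT1 phi0 [C hC].
have [s _ hs] := EVT_max TT1 cont.
exists (Num.max C (phi s * expR (L s))) => t Tt.
have e0 := expR_ge0 (- L t).
have [T1t|tT1] := leP T1 t.
  by apply: le_trans (hC _ T1t) _; rewrite ler_wpM2r// le_max lexx.
rewrite ger0_norm// -[phi t]mulr1 -[X in _ * X](expRxMexpNx_1 (L t)) mulrA.
have st : phi t * expR (L t) <= phi s * expR (L s).
  by apply: hs; rewrite in_itv/= Tt ltW.
by rewrite ler_wpM2r// le_max st orbT.
Qed.

Theorem theorem2 (R : realType) (n : nat) (r alpha mu : R)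
    (hr : 0 < r) (halpha0 : 0 < alpha) (halpha1 : alpha < 1) (hmu : 0 < mu)
    (f : 'rV[R]_n -> R) (fstar : R)
    (hfdiff : forall z : 'rV[R]_n, differentiable f z)
    (hfconv : strongly_convex mu f)
    (hfstar : is_minimum_value f fstar)
    (x : R -> 'rV[R]_n)
    (hx : is_solution r alpha f x) :
  bigO_from ((2 * r ^+ 2 / (9 * mu)) `^ (1 / (2 * alpha)))
    (fun t : R => f (x t) - fstar)
    (fun t : R => expR (- (2 / 3 * (r / (1 - alpha)) * t `^ (1 - alpha)))).
Proof.
case: hfstar => -[xstar <-] fmin.
pose L (t : R) := 2 / 3 * (r / (1 - alpha)) * t `^ (1 - alpha).
pose l (t : R) := 2 / 3 * r * t `^ (- alpha).
pose dl (t : R) := 2 / 3 * r * - alpha * t `^ (- alpha - 1).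
pose ddl (t : R) :=
  2 / 3 * r * - alpha * (- alpha - 1) * t `^ (- alpha - 1 - 1).
set T := (_ `^ _) in |- *.
have T0 : 0 < T by rewrite powR_gt0// divr_gt0// mulr_gt0// exprn_gt0.
(* From this time on, l ^+ 2 <= mu / 2: the constant is 4 times that of T
   because the bound 2 * mu met at T has to be divided by 4. *)
pose T1 := (8 * r ^+ 2 / (9 * mu)) `^ (1 / (2 * alpha)).
have TT1 : T <= T1.
  apply: ge0_ler_powR; rewrite ?nnegrE.
  - by rewrite divr_ge0// mulr_ge0// ltW.
  - by rewrite divr_ge0// mulr_ge0// ?sqr_ge0 ?ltW.
  - by rewrite divr_ge0// mulr_ge0// ?sqr_ge0 ?ltW.
  - rewrite ler_wpM2r ?invr_ge0 ?mulr_ge0 ?ltW// ltr_pM2r ?exprn_gt0//.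
    by rewrite ltr_nat.
have T1_gt0 : 0 < T1 by exact: lt_le_trans TT1.
have dL (t : R) : 0 < t -> is_derive t 1 L (l t).
  move=> t0; apply: (is_derive_eq (is_derive_mulr_powR _ (1 - alpha) t0)).
  have -> : 1 - alpha - 1 = - alpha by ring.
  by congr (_ * _); field; rewrite subr_eq0 gt_eqF.
have l_small (t : R) : T1 <= t -> l t ^+ 2 <= mu / 2.
  move=> T1t; have t0 := lt_le_trans T1_gt0 T1t.
  have p0 : 0 < (t `^ alpha) ^+ 2 by rewrite exprn_gt0// powR_gt0.
  have c0 : 0 <= 8 * r ^+ 2 / (9 * mu).
    by rewrite divr_ge0// mulr_ge0// ?sqr_ge0 ?ltW.
  have := le_sqr_powR halpha0 c0 T1t; rewrite /l powRN.
  rewrite ler_pdivrMr ?mulr_gt0// exprMn exprVn ler_pdivrMr//.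
  by lra.
have gap0 (t : R) : 0 <= f (x t) - f xstar by rewrite subr_ge0.
have rate (t : R) : T1 <= t -> lyapunov_rate f xstar x l dl ddl t
    + l t * lyapunov f xstar x l dl t <= 0.
  move=> T1t; have t0 := lt_le_trans T1_gt0 T1t.
  have [_ _ ode] := hx _ t0.
  apply: (lyapunov_rate_le _ _ hfconv).
  - rewrite -[RHS]ode /l powRN; congr (_ + _ *: _ + _).
    by field; rewrite gt_eqF ?powR_gt0.
  - by rewrite !mulr_ge0 ?powR_ge0// ltW.
  - by have := l_small t T1t; lra.
  - by rewrite /ddl mulr_ge0 ?powR_ge0//; nra.
have dW (t : R) : T1 <= t -> is_derive t 1 (lyapunov f xstar x l dl)
    (lyapunov_rate f xstar x l dl ddl t).
  move=> T1t; have t0 := lt_le_trans T1_gt0 T1t.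
  have [dx ddx _] := hx _ t0.
  exact: (is_derive_lyapunov xstar (hfdiff (x t)) dx ddx
    (is_derive_mulr_powR (2 / 3 * r) (- alpha) t0)
    (is_derive_mulr_powR (2 / 3 * r * - alpha) (- alpha - 1) t0)).
apply: (@bigO_from_extend _ T T1 _ L) => //.
  apply: derivable_within_continuous => t.
  rewrite in_itv/= => /andP[Tt _]; have t0 := lt_le_trans T0 Tt.
  have [/derivableP dx _ _] := hx _ t0.
  have df := is_derive_along (hfdiff (x t)) dx.
  have hc : is_derive t 1 (cst (f xstar)) 0 by exact: is_derive_cst.
  have dE := is_derive1_comp (is_derive_expR (L t)) (dL t t0).
  by have [] := is_deriveM (is_deriveB df hc) dE.
exists (2 * (expR (L T1) * lyapunov f xstar x l dl T1)) => t T1t.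
rewrite ger0_norm//.
have t0 := lt_le_trans T1_gt0 T1t.
have decay := exp_weighted_nincr
  (fun s (h : T1 <= s) => dL s (lt_le_trans T1_gt0 h)) dW rate T1t.
have dl0 : dl t <= 0.
  by rewrite /dl mulrN mulNr oppr_le0 !mulr_ge0 ?powR_ge0// ltW.
have half_gap := lyapunov_ge_half_gap x hfconv fmin (l_small t T1t) dl0.
rewrite expRN ler_pdivlMr ?expR_gt0//.
move: decay (ler_wpM2l (expR_ge0 (L t)) half_gap).
move: (expR (L T1) * _) (lyapunov _ _ _ _ _ t) (expR (L t)) => c w e.
by lra.
Qed.
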